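(* Let $m,n,r$ be positive integers with $r<\min\{m,n\}$ and let $f:\mathbb{R}^{m\times n}\to\mathbb{R}$ be differentiable with locally Lipschitz continuous gradient. Let $h:\mathbb{R}^{m\times n}\to\mathbb{R}$ be differentiable and such that $h|_{\mathbb{R}^{m\times n}_{\le r}}=f|_{\mathbb{R}^{m\times n}_{\le r}}$. Then $X\in\mathbb{R}^{m\times n}_{\le r}$ is M-stationary for the minimization of $h$ on $\mathbb{R}^{m\times n}_{\le r}$ if and only if $X$ is M-stationary for the minimization of $f$ on $\mathbb{R}^{m\times n}_{\le r}$.
   Context: $\mathbb{R}^{m\times n}$ carries the Frobenius inner product $\langle X,Y\rangle=\operatorname{tr}(Y^\top X)$; $\mathbb{R}^{m\times n}_{\le r}=\{X\in\mathbb{R}^{m\times n}\mid \operatorname{rank}X\le r\}$. For a nonempty set $S$ and $x\in S$: the tangent cone $T_S(x)$ is the set of all $v$ for which there exist sequences $(x_i)$ in $S$ converging to $x$ and $(t_i)$ in $(0,\infty)$ with $(x_i-x)/t_i\to v$; the regular normal cone is $\widehat N_S(x)=\{w\mid\langle v,w\rangle\le 0\ \forall v\in T_S(x)\}$; the normal cone $N_S(x)$ is the set of all $w$ for which there exist sequences $(x_i)$ in $S$ converging to $x$ and $(w_i)$ converging to $w$ with $w_i\in\widehat N_S(x_i)$ for all $i$. For a differentiable function $\psi:\mathbb{R}^{m\times n}\to\mathbb{R}$, a point $X\in\mathbb{R}^{m\times n}_{\le r}$ is M-stationary for the minimization of $\psi$ on $\mathbb{R}^{m\times n}_{\le r}$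 if $-\nabla\psi(X)\in N_{\mathbb{R}^{m\times n}_{\le r}}(X)$. *)

(* Defs.v *)
From mathcomp Require Import all_boot all_order all_algebra.
From mathcomp Require Import all_classical all_reals all_analysis.
Import Order.TTheory GRing.Theory Num.Theory.
Import numFieldNormedType.Exports.

Set Implicit Arguments.
Unset Strict Implicit.
Unset Printing Implicit Defensive.

Local Open Scope classical_set_scope.
Local Open Scope ring_scope.

Definition frobenius (R : realType) (m n : nat) (X Y : 'M[R]_(m, n)) : R :=
  \tr (Y^T *m X).

Definition rank_le (R : realType) (m n r : nat) : set 'M[R]_(m, n) :=
  [set X | (\rank X <= r)%N].

Arguments rank_le : clear implicits.

Definition tangent_cone (R : realType) (m n : nat) (S : set 'M[R]_(m, n))
    (x : 'M[R]_(m, n)) : set 'M[R]_(m, n) :=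
  [set v | exists (x_ : nat -> 'M[R]_(m, n)) (t_ : nat -> R),
    [/\ forall i, S (x_ i), x_ @ \oo --> x, forall i, 0 < t_ i &
        (fun i => (t_ i)^-1 *: (x_ i - x)) @ \oo --> v]].

Definition regular_normal_cone (R : realType) (m n : nat)
    (S : set 'M[R]_(m, n)) (x : 'M[R]_(m, n)) : set 'M[R]_(m, n) :=
  [set w | forall v, tangent_cone S x v -> frobenius v w <= 0].

Definition normal_cone (R : realType) (m n : nat) (S : set 'M[R]_(m, n))
    (x : 'M[R]_(m, n)) : set 'M[R]_(m, n) :=
  [set w | exists x_ w_ : nat -> 'M[R]_(m, n),
    [/\ forall i, S (x_ i), x_ @ \oo --> x, w_ @ \oo --> w &
        forall i, regular_normal_cone S (x_ i) (w_ i)]].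

(* Since ['d psi X] is linear by construction, this matrix always represents
   it for [frobenius]: see [gradientP] and [gradient_unique]. *)
Definition gradient (R : realType) (m n : nat) (psi : 'M[R]_(m, n) -> R)
    (X : 'M[R]_(m, n)) : 'M[R]_(m, n) :=
  \matrix_(i, j) 'd psi X (delta_mx i j).

Lemma frobeniusE (R : realType) (m n : nat) (X Y : 'M[R]_(m, n)) :
  frobenius X Y = \sum_i \sum_j X i j * Y i j.
Proof.
rewrite /frobenius /mxtrace exchange_big; apply: eq_bigr => j _.
by rewrite mxE; apply: eq_bigr => i _; rewrite mxE mulrC.
Qed.

Lemma gradientP (R : realType) (m n : nat) (psi : 'M[R]_(m, n) -> R)
    (X H : 'M[R]_(m, n)) :
  'd psi X H = frobenius H (gradient psi X).
Proof.
rewrite frobeniusE {1}[H]matrix_sum_delta linear_sum; apply: eq_bigr => i _.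
rewrite linear_sum; apply: eq_bigr => j _.
by rewrite linearZ /gradient mxE.
Qed.

Lemma gradient_unique (R : realType) (m n : nat) (psi : 'M[R]_(m, n) -> R)
    (X G : 'M[R]_(m, n)) :
  (forall H, 'd psi X H = frobenius H G) -> G = gradient psi X.
Proof.
move=> dG; apply/matrixP => i j; rewrite mxE dG frobeniusE.
rewrite (bigD1 i)//= (bigD1 j)//= !mxE !eqxx mul1r big1 ?addr0 => [|k kj].
  rewrite big1 ?addr0// => k ki; rewrite big1// => l _.
  by rewrite mxE (negbTE ki) mul0r.
by rewrite mxE (negbTE kj) andbF mul0r.
Qed.

(* The library norm on ['M[R]_(m, n)] is the entrywise max norm, not the
   Frobenius norm; by equivalence of norms this affects neither convergence,
   nor differentiability, nor local Lipschitz continuity. *)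
Definition locally_lipschitz (R : realType) (V W : normedModType R)
    (g : V -> W) : Prop :=
  forall x : V, exists2 U : set V, nbhs x U & [lipschitz g y | y in U].

Definition M_stationary (R : realType) (m n : nat) (psi : 'M[R]_(m, n) -> R)
    (S : set 'M[R]_(m, n)) (X : 'M[R]_(m, n)) : Prop :=
  S X /\ normal_cone S X (- gradient psi X).

(* Main.v *)
Require Import Defs.
From mathcomp Require Import all_boot all_order all_algebra.
From mathcomp Require Import all_classical all_reals all_analysis.
Import Order.TTheory GRing.Theory Num.Theory.
Import numFieldNormedType.Exports.

Local Open Scope classical_set_scope.
Local Open Scope ring_scope.

(* If rank X < r, every matrix unit is a direction along which the rank stays
   at most r, so h and f have the same gradient at X.  If rank X = r, the
   normal cone at X is the linear space
   {W | X W^T = 0 and W^T X = 0}, and the two gradients differ by an element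
   of it, because h and f agree along the curves (1 + tA) X and X (1 + tB). *)

(** * Entrywise limits of matrices and continuity of matrix operations *)

Lemma cvg_eq_cst {R : realType} {V : normedModType R} {T : Type}
    {F : set_system T} {FF : ProperFilter F} {u : T -> V} {c l : V} :
  (forall x, u x = c) -> u @ F --> l -> l = c.
Proof.
move=> uc ul; have {uc} -> : c = lim (u @ F).
  by rewrite (_ : u = cst c) ?lim_cst//; exact/funext.
by apply/esym/cvg_lim.
Qed.

Section matrix_cvg.
Context {R : realType} {T : Type} {F : set_system T} {FF : Filter F}.

Lemma cvg_mxP m n (u : T -> 'M[R]_(m, n)) (l : 'M[R]_(m, n)) :
  u @ F --> l <-> forall i j, u x i j @[x --> F] --> l i j.
Proof.
split=> [ul i j|ul].
  exact: (cvg_comp _ _ ul (@coord_continuous R m n i j l)).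
apply/cvgrPdist_le => /= e e0; near=> x.
rewrite /Num.Def.normr/= mx_normrE (bigmax_le _ (ltW e0))//= => i _.
rewrite !mxE/=.
(* There are finitely many index pairs, so the entrywise estimates eventually hold all at once. *)
move: i; near: x; apply: filter_forall => /= i.
exact: ((cvgrPdist_le _ _).1 (ul i.1 i.2)).
Unshelve. all: by end_near. Qed.

Lemma cvg_mulmx m n p (u : T -> 'M[R]_(m, n)) (v : T -> 'M[R]_(n, p))
    (a : 'M[R]_(m, n)) (b : 'M[R]_(n, p)) :
  u @ F --> a -> v @ F --> b -> u x *m v x @[x --> F] --> a *m b.
Proof.
move=> /cvg_mxP ua /cvg_mxP vb; apply/cvg_mxP => i j; rewrite mxE.
under eq_cvg do rewrite mxE.
by apply: cvg_big; [exact: add_continuous|move=> k _; exact: cvgM].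
Qed.

Lemma cvg_trmx m n (u : T -> 'M[R]_(m, n)) (a : 'M[R]_(m, n)) :
  u @ F --> a -> (u x)^T @[x --> F] --> a^T.
Proof.
move=> /cvg_mxP ua; apply/cvg_mxP => i j; rewrite mxE.
under eq_cvg do rewrite mxE.
exact: ua.
Qed.

Lemma cvg_col_mx m1 m2 n (u : T -> 'M[R]_(m1, n)) (v : T -> 'M[R]_(m2, n))
    (a : 'M[R]_(m1, n)) (b : 'M[R]_(m2, n)) :
  u @ F --> a -> v @ F --> b -> col_mx (u x) (v x) @[x --> F] --> col_mx a b.
Proof.
move=> /cvg_mxP ua /cvg_mxP vb; apply/cvg_mxP => i j; rewrite mxE.
under eq_cvg do rewrite mxE.
by case: (fintype.split i) => k; [exact: ua|exact: vb].
Qed.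

Lemma cvg_det n (u : T -> 'M[R]_n) (a : 'M[R]_n) :
  u @ F --> a -> \det (u x) @[x --> F] --> \det a.
Proof.
move=> /cvg_mxP ua; apply: cvg_big; first exact: add_continuous.
move=> s _; apply: cvgM; first exact: cvg_cst.
by apply: cvg_big; [exact: mul_continuous|move=> i _; exact: ua].
Qed.

End matrix_cvg.

(** * Closedness of the rank bound *)

(** Gaussian elimination writes [M] as invertible * [pid_mx (\rank M)] * invertible; undoing both
    factors and truncating to size [k] gives [U] and [Z]. *)
Lemma mxrank_minor {K : fieldType} m n k (M : 'M[K]_(m, n)) :
  (k <= \rank M)%N ->
  exists (U : 'M[K]_(k, m)) (Z : 'M[K]_(n, k)), U *m M *m Z = 1%:M.
Proof.
move=> kM; have km := leq_trans kM (rank_leq_row M).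
have kn := leq_trans kM (rank_leq_col M).
exists (pid_mx k *m invmx (col_ebase M)), (invmx (row_ebase M) *m pid_mx k).
rewrite -{2}(mulmx_ebase M) !mulmxA mulmxKV ?col_ebase_unit//.
rewrite mulmxK ?row_ebase_unit// !mul_pid_mx (minn_idPl kM).
by rewrite (minn_idPr km) minnn (minn_idPr kn) pid_mx_1.
Qed.

(** If [a] had rank above [r], some [U *m a *m Z] would be the identity of size [r.+1]. The matrices
    [U *m u i *m Z] have rank at most [r], hence determinant 0, and continuity of [\det] would give
    1 = 0. *)
Lemma cvg_rank_le (R : realType) m n r (u : nat -> 'M[R]_(m, n))
    (a : 'M[R]_(m, n)) :
  (forall i, (\rank (u i) <= r)%N) -> u @ \oo --> a -> (\rank a <= r)%N.
Proof.
move=> ur ua; rewrite leqNgt; apply/negP => /mxrank_minor[U [Z UaZ]].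
have det0 i : \det (U *m u i *m Z) = 0.
  apply/eqP; apply: contraTT (ur i) => detN0.
  have : U *m u i *m Z \in unitmx by rewrite unitmxE unitfE.
  rewrite -row_full_unit => /eqP rk; rewrite -ltnNge -[r.+1]rk.
  by rewrite (leq_trans (mxrankM_maxl _ _))// mxrankM_maxr.
have /(cvg_eq_cst det0)/eqP :
    \det (U *m u i *m Z) @[i --> \oo] --> \det (U *m a *m Z).
  apply: cvg_det; apply: cvg_mulmx; last exact: cvg_cst.
  by apply: cvg_mulmx => //; exact: cvg_cst.
by rewrite UaZ det1 oner_eq0.
Qed.

(** * Orthogonality for the Frobenius product *)

(** Testing with [A = w *m B] turns the pairing into the sum of the squared entries of [w *m B]. *)
Lemma mulmx_eq0_frobenius (R : realType) m n k (w : 'M[R]_(m, n))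
    (B : 'M[R]_(n, k)) :
  (forall A : 'M[R]_(m, k), frobenius (A *m B^T) w <= 0) -> w *m B = 0.
Proof.
move=> /(_ (w *m B)) le0.
have : \sum_i \sum_j (w *m B) i j * (w *m B) i j <= 0.
  rewrite -frobeniusE; apply: le_trans le0.
  by rewrite /frobenius trmx_mul mxtrace_mulC [leRHS]mxtrace_mulC !mulmxA.
move=> sum_le0; have ge0 i : 0 <= \sum_j (w *m B) i j * (w *m B) i j.
  by apply: sumr_ge0 => j _; rewrite -expr2 sqr_ge0.
have /eqP : \sum_i \sum_j (w *m B) i j * (w *m B) i j = 0.
  by apply/le_anti/andP; split=> //; apply: sumr_ge0.
rewrite psumr_eq0// => /allP sum0; apply/matrixP => i j.
have := sum0 i; rewrite mem_index_enum psumr_eq0 => [/(_ isT)/allP|k' _].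
  move=> /(_ j); rewrite mem_index_enum -expr2 sqrf_eq0 [RHS]mxE.
  by move=> /(_ isT)/eqP.
by rewrite -expr2 sqr_ge0.
Qed.

Lemma frobenius_tr (R : realType) m n (v w : 'M[R]_(m, n)) :
  frobenius v^T w^T = frobenius v w.
Proof. by rewrite /frobenius trmxK -mxtrace_tr trmx_mul trmxK mxtrace_mulC. Qed.

Lemma frobenius_delta (R : realType) m n i j (a : 'M[R]_(m, n)) :
  frobenius (delta_mx i j) a = a i j.
Proof.
rewrite frobeniusE (bigD1 i)//= (bigD1 j)//= mxE !eqxx mul1r.
rewrite !big1 ?addr0// => [k ki|k kj].
  by rewrite big1// => l _; rewrite mxE (negbTE ki) mul0r.
by rewrite mxE (negbTE kj) andbF mul0r.
Qed.

Lemma frobeniusBr (R : realType) m n (v a b : 'M[R]_(m, n)) :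
  frobenius v (a - b) = frobenius v a - frobenius v b.
Proof. by rewrite /frobenius linearB mulmxBl linearB. Qed.

Lemma orthogonal_tangents (R : realType) m n (x w : 'M[R]_(m, n)) :
  (forall A : 'M[R]_m, frobenius (A *m x) w <= 0) ->
  (forall B : 'M[R]_n, frobenius (x *m B) w <= 0) ->
  x *m w^T = 0 /\ w^T *m x = 0.
Proof.
move=> hA hB; split.
  apply: trmx_inj; rewrite trmx_mul trmxK trmx0.
  apply: mulmx_eq0_frobenius => A.
  by rewrite trmxK.
apply: mulmx_eq0_frobenius => B.
by rewrite -frobenius_tr !trmxK trmx_mul trmxK.
Qed.

Lemma tangent_cone_line (R : realType) m n (S : set 'M[R]_(m, n)) x v :
  (forall t : R, S (x + t *: v)) -> tangent_cone S x v.
Proof.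
move=> Sv; exists (fun i => x + harmonic i *: v), harmonic; split => //.
- rewrite -[X in _ --> X]addr0 -(scale0r v).
  by apply: cvgD; [exact: cvg_cst|apply: cvgZr_tmp; exact: cvg_harmonic].
- by move=> i; rewrite /harmonic invr_gt0 ltr0n.
- apply: (@cvg_trans _ (nbhs v)) => //.
  under eq_cvg do
    rewrite addrAC subrr add0r scalerA mulVf ?scale1r ?invr_eq0 ?pnatr_eq0//.
  exact: cvg_cst.
Qed.

(** * Tangent and normal cones of the set of matrices of bounded rank *)

Section rank_le.
Context {R : realType} {m n r : nat}.
Implicit Types x v w : 'M[R]_(m, n).
Local Notation S := (rank_le R m n r).

Lemma rank_le_lmul x (A : 'M[R]_m) (t : R) : S x -> S (x + t *: (A *m x)).
Proof.
rewrite /rank_le/= => xr; rewrite -{1}[x]mul1mx scalemxAl -mulmxDl.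
exact: leq_trans (mxrankM_maxr _ _) xr.
Qed.

Lemma rank_le_rmul x (B : 'M[R]_n) (t : R) : S x -> S (x + t *: (x *m B)).
Proof.
rewrite /rank_le/= => xr; rewrite -{1}[x]mulmx1 scalemxAr -mulmxDr.
exact: leq_trans (mxrankM_maxl _ _) xr.
Qed.

Lemma rank_le_delta x i j (t : R) :
  (\rank x < r)%N -> S (x + t *: delta_mx i j).
Proof.
move=> xr; apply: leq_trans (mxrank_add _ _) _.
by rewrite (leq_trans _ xr)// -addn1 leq_add2l (leq_trans (mxrank_scale _ _))//
  mxrank_delta.
Qed.

(** Multiplication by a matrix on either side cannot raise the rank, so all [A *m x] and [x *m B]
    are tangent, whatever the rank of [x]. *)
Lemma regular_normal_cone_orthogonal x w :
  S x -> regular_normal_cone S x w -> x *m w^T = 0 /\ w^T *m x = 0.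
Proof.
move=> Sx Nw; apply: orthogonal_tangents => A; apply: Nw;
  apply: tangent_cone_line => t.
- exact: rank_le_lmul.
- exact: rank_le_rmul.
Qed.

(* For [P *m x = 0], the matrices [col_mx 1%:M (t_i^-1 *: P) *m x_i] have rank
   at most [r] and converge to [col_mx x (P *m v)]. *)
Lemma tangent_cone_sub x v (P : 'M[R]_m) :
  \rank x = r -> P *m x = 0 -> tangent_cone S x v -> (P *m v <= x)%MS.
Proof.
move=> rx Px [x_ [t_ [Sx_ xx _ xv]]].
have rk : (\rank (col_mx x (P *m v)) <= r)%N.
  apply: (@cvg_rank_le _ _ _ _ (fun i =>
    col_mx (x_ i) (P *m ((t_ i)^-1 *: (x_ i - x))))) => [i|].
    rewrite -scalemxAr mulmxBr Px subr0 scalemxAl -{1}[x_ i]mul1mx -mul_col_mx.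
    exact: leq_trans (mxrankM_maxr _ _) (Sx_ i).
  by apply: cvg_col_mx => //; apply: cvg_mulmx xv; exact: cvg_cst.
(* The stacked matrix contains the row space of [x] and has rank at most [r = \rank x], so both row
   spaces coincide. *)
have xsub : (x <= col_mx x (P *m v))%MS by rewrite -addsmxE addsmxSl.
have /eqmxP eqx : (x == col_mx x (P *m v))%MS.
  by rewrite -(mxrank_leqif_eq xsub) eqn_leq mxrankS//= rx.
by rewrite eqx -addsmxE addsmxSr.
Qed.

Lemma orthogonal_regular_normal_cone x w :
  \rank x = r -> x *m w^T = 0 -> w^T *m x = 0 -> regular_normal_cone S x w.
Proof.
(* [P] annihilates [x] from the left and fixes the rows of [w^T], which lie in the left kernel of
   [x]. Hence tr([w^T *m v]) = tr([w^T *m P *m v]), and [P *m v = D *m x] makes this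
   tr([D *m x *m w^T]) = 0. *)
move=> rx xw wx v vT; pose P := pinvmx (kermx x) *m kermx x.
have wP : w^T *m P = w^T.
  by rewrite mulmxA mulmxKpV//; apply/sub_kermxP.
have /submxP[D PvD] : (P *m v <= x)%MS.
  by apply: tangent_cone_sub => //; rewrite -mulmxA mulmx_ker mulmx0.
by rewrite /frobenius -wP -mulmxA PvD mxtrace_mulC -mulmxA xw mulmx0 mxtrace0.
Qed.

(** Regular normals at all the approximating points satisfy the two equations, which pass to the
    limit by continuity. Conversely, constant sequences suffice. *)
Lemma normal_coneP x w : \rank x = r ->
  normal_cone S x w <-> x *m w^T = 0 /\ w^T *m x = 0.
Proof.
move=> rx; have Sx : S x by rewrite /rank_le/= rx.
split=> [[x_ [w_ [Sx_ xx ww Nw]]]|[xw wx]]; last first.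
  exists (fun=> x), (fun=> w); split; [by []|exact: cvg_cst|exact: cvg_cst|].
  by move=> _; exact: orthogonal_regular_normal_cone.
have ort i := regular_normal_cone_orthogonal _ _ (Sx_ i) (Nw i).
split.
- apply: (cvg_eq_cst (F := \oo) (fun i => (ort i).1)).
  by apply: cvg_mulmx => //; exact: cvg_trmx.
- apply: (cvg_eq_cst (F := \oo) (fun i => (ort i).2)).
  by apply: cvg_mulmx => //; exact: cvg_trmx.
Qed.

Lemma normal_cone_eq_on_lines x (a b : 'M[R]_(m, n)) : S x ->
  (forall v, (forall t : R, S (x + t *: v)) -> frobenius v a = frobenius v b) ->
  normal_cone S x (- a) <-> normal_cone S x (- b).
Proof.
move=> Sx ab; move: (Sx); rewrite /rank_le/= leq_eqVlt.
move=> /predU1P[rx|ltxr]; last first.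
  suff -> : a = b by [].
  apply/matrixP => i j; rewrite -!frobenius_delta.
  by apply: ab => t; exact: rank_le_delta.
(* Both signs of the pairing are harmless here: [a - b] is orthogonal to every [A *m x] and
   [x *m B]. *)
have [xd dx] : x *m (a - b)^T = 0 /\ (a - b)^T *m x = 0.
  apply: orthogonal_tangents => A; rewrite frobeniusBr ab ?subrr// => t.
  - exact: rank_le_lmul.
  - exact: rank_le_rmul.
have xab : x *m a^T = x *m b^T.
  by apply/eqP; rewrite -subr_eq0 -mulmxBr -linearB xd.
have abx : a^T *m x = b^T *m x.
  by apply/eqP; rewrite -subr_eq0 -mulmxBl -linearB dx.
have trN (c : 'M[R]_(m, n)) : (- c)^T = - c^T by rewrite linearN.
by rewrite !normal_coneP// !trN !mulmxN !mulNmx xab abx.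
Qed.

End rank_le.

(** Both sides are derivatives at [x] along [v], and their difference quotients coincide because the
    whole line stays in [S]. *)
Lemma frobenius_gradient_line (R : realType) m n (S : set 'M[R]_(m, n))
    (f h : 'M[R]_(m, n) -> R) x v :
  differentiable f x -> differentiable h x -> {in S, h =1 f} ->
  (forall t : R, S (x + t *: v)) ->
  frobenius v (gradient h x) = frobenius v (gradient f x).
Proof.
move=> df dh hf Sv; rewrite -(gradientP h) -(gradientP f).
rewrite -(deriveE _ df) -(deriveE _ dh) /derive.
have hfv t : h (x + t *: v) = f (x + t *: v) by apply: hf; rewrite inE.
have hfx : h x = f x by have := hfv 0; rewrite scale0r addr0.
suff -> : (fun t : R => t^-1 *: ((h \o shift x) (t *: v) - h x)) =
    (fun t : R => t^-1 *: ((f \o shift x) (t *: v) - f x)) by [].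
by apply/funext => t /=; rewrite hfx [t *: v + x]addrC hfv.
Qed.

Theorem proposition2p9 (R : realType) (m n r : nat)
    (hm : (0 < m)%N) (hn : (0 < n)%N) (hr : (0 < r)%N) (hrmn : (r < minn m n)%N)
    (f : 'M[R]_(m, n) -> R) (hf : forall X, differentiable f X)
    (hflip : locally_lipschitz (gradient f))
    (h : 'M[R]_(m, n) -> R) (hh : forall X, differentiable h X)
    (hfh : {in rank_le R m n r, h =1 f}) (X : 'M[R]_(m, n))
    (hX : rank_le R m n r X) :
  M_stationary h (rank_le R m n r) X <-> M_stationary f (rank_le R m n r) X.
Proof.
have N := normal_cone_eq_on_lines X (gradient h X) (gradient f X) hX
  (fun v => @frobenius_gradient_line R m n _ f h X v (hf X) (hh X) hfh).
split=> -[_ nX]; (split; first exact: hX).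
- exact: (N.1 nX).
- exact: (N.2 nX).
Qed.
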